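(* Let $\kappa\in(0,1)$. Then there is a real recurrence sequence $(f_n)$ with no positive real dominating characteristic root such that $\boldsymbol{d}(\{n\in\mathbb{N} : f_n>0\})=\kappa$.
   Context: A real sequence $(f_n)_{n\geq 0}$ is a recurrence sequence if $f_{n+h}=c_1f_{n+h-1}+\dots+c_hf_n$ for all $n\geq0$, for some $h\geq1$ and $c_k\in\mathbb{R}$. Such a sequence can be written uniquely as $f_n=\sum_{k=0}^m P_k(n)\gamma_k^n$ with distinct $\gamma_k\in\mathbb{C}$ and nonzero polynomials $P_k\in\mathbb{C}[n]$; the $\gamma_k$ are its characteristic roots, and those of maximal modulus are its dominating roots. $\boldsymbol{d}(A)=\lim_{x\to\infty}x^{-1}\#\{n\leq x: n\in A\}$ denotes the natural density of $A\subseteq\mathbb{N}$. *)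

(* Defs.v *)
From HB Require Import structures.
From mathcomp Require Import all_boot all_order all_algebra.
From mathcomp Require Import finmap complex.
From mathcomp Require Import all_classical all_reals all_analysis.

Set Implicit Arguments.
Unset Strict Implicit.
Unset Printing Implicit Defensive.

Import Order.TTheory GRing.Theory Num.Theory.
Import numFieldNormedType.Exports.

Local Open Scope classical_set_scope.
Local Open Scope ring_scope.
Local Open Scope complex_scope.

(* The coefficient written c_(k+1) in the usual 1-based convention is [c k]. *)
Definition recurrence_sequence (R : realType) (f : nat -> R) : Prop :=
  exists (h : nat) (c : 'I_h -> R), (0 < h)%N /\
    forall n : nat, f (n + h)%N = \sum_(k < h) c k * f (n + h - k.+1)%N.

(* The roots are required to be nonzero: this is what makes the expansion of
   [f] unique, since [0 ^+ n] vanishes for all n > 0, so that distinct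
   polynomials attached to the root 0 could give the same sequence.  Hence the
   [gamma k] are the characteristic roots of [f]. *)
Definition characteristic_expansion (R : realType) (f : nat -> R) (m : nat)
    (gamma : 'I_m.+1 -> R[i]) (P : 'I_m.+1 -> {poly R[i]}) : Prop :=
  [/\ injective gamma,
      forall k, gamma k != 0,
      forall k, P k != 0 &
      forall n : nat, (f n)%:C = \sum_(k < m.+1) (P k).[n%:R] * gamma k ^+ n].

Definition dominating (R : realType) (m : nat) (gamma : 'I_m.+1 -> R[i])
    (k : 'I_m.+1) : Prop :=
  forall j, `|gamma j| <= `|gamma k|.

Definition positive_real (R : realType) (z : R[i]) : Prop :=
  exists2 r : R, 0 < r & z = r%:C.

Definition has_natural_density (R : realType) (A : set nat) (d : R) : Prop :=
  (fun x : R => x^-1 * #|` fset_set [set n : nat | n%:R <= x /\ A n] |%:R)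
    @ +oo --> d.

(* Main.v *)
Require Import Defs.
From HB Require Import structures.
From mathcomp Require Import all_boot all_order all_algebra.
From mathcomp Require Import finmap complex.
From mathcomp Require Import all_classical all_reals all_analysis.
From mathcomp Require Import ring lra zify.

Set Implicit Arguments.
Unset Strict Implicit.
Unset Printing Implicit Defensive.

Import Order.TTheory GRing.Theory Num.Theory.
Import numFieldNormedType.Exports.

Local Open Scope classical_set_scope.
Local Open Scope ring_scope.
Local Open Scope complex_scope.

(* Rotate the circle by [b] along each residue class modulo [q] and compare
   [cos (2 pi u)] with [cos (pi b)]: the arc so cut out has length exactly the
   rotation angle, so visits to it are counted by differences of floors, which
   telescope, and the arc has density [b] in each class with bounded error; no
   equidistribution theorem is needed.  The constant [cos (pi b)] would create
   the characteristic root 1; adding a [q]-periodic term supported on the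
   classes 0 and 1 makes the periodic part have mean zero, which removes this
   root, and forces the sign on these two classes.  The density is then
   [(1 + (q - 2) b) / q], and [b] and [q] are chosen to make it [kappa]. *)

(** * Natural density from bounded discrepancy *)

Lemma natural_density_bounded_discrepancy (R : realType) (a : pred nat) (d C : R) :
  (forall N, `|\sum_(n < N) (a n)%:R - d * N%:R| <= C) ->
  has_natural_density [set n | a n] d.
Proof.
move=> discr; have C0 : 0 <= C by apply: le_trans (discr 0%N).
have cardE (x : R) : 0 <= x ->
    #|` fset_set [set n : nat | n%:R <= x /\ a n] |%:R =
    \sum_(n < (Num.truncn x).+1) (a n)%:R :> R.
  move=> x0; pose s := [seq n <- iota 0 (Num.truncn x).+1 | a n].
  have -> : [set n : nat | n%:R <= x /\ a n] = [set` [fset n in s]%fset].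
    apply/seteqP; split=> n /=; rewrite inE/= mem_filter mem_iota add0n/= ltnS
      truncn_ge_nat//.
    - by case=> -> ->.
    - by case/andP.
  rewrite set_fsetK card_fseq undup_id ?filter_uniq ?iota_uniq//.
  rewrite size_filter -sum1_count big_mkcond natr_sum -[in RHS](big_mkord xpredT
    (fun n => (a n)%:R)) /index_iota subn0.
  by apply: eq_bigr => n _; case: (a n).
apply/cvgrPdist_lt => e e0; near=> x.
have x0 : 0 < x by near: x; apply: nbhs_pinfty_gt; exact: num_real.
(* The error at [x] is at most (C + |d|) / x: the discrepancy costs C, and replacing [x] by the
   number [N.+1] of integers in [0, x] costs at most |d|. *)
have xe : (C + `|d|) / e < x by near: x; apply: nbhs_pinfty_gt; exact: num_real.
rewrite cardE ?ltW//.
have := truncn_itv (ltW x0).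
set N := Num.truncn x => /andP[Nx xN].
have -> : d - x^-1 * (\sum_(n < N.+1) (a n)%:R) =
    x^-1 * (d * (x - N.+1%:R) - (\sum_(n < N.+1) (a n)%:R - d * N.+1%:R)).
  by field; rewrite gt_eqF.
rewrite normrM gtr0_norm ?invr_gt0// [x^-1 * _]mulrC ltr_pdivrMr//.
apply: (@le_lt_trans _ _ (C + `|d|)); last by rewrite mulrC -ltr_pdivrMr.
apply: (le_trans (ler_normB _ _)); rewrite addrC; apply: lerD => //.
rewrite normrM -[leRHS]mulr1 ler_wpM2l//.
by move: Nx xN; rewrite -natr1 ler_norml => ? ?; apply/andP; split; lra.
Unshelve. all: by end_near. Qed.

(** An incomplete last block has r < q terms, and both its count and its expected count [d * r] lie
    in [0, q]. *)
Lemma bounded_discrepancy_mul (R : realType) (a : pred nat) (d C : R) (q : nat) :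
  (0 < q)%N -> 0 <= d <= 1 ->
  (forall k, `|\sum_(n < k * q) (a n)%:R - d * (k * q)%:R| <= C) ->
  forall N, `|\sum_(n < N) (a n)%:R - d * N%:R| <= C + q%:R.
Proof.
move=> q0 /andP[d0 d1] discr N; rewrite (divn_eq N q).
have := discr (N %/ q)%N; have := ltn_mod N q; rewrite q0.
move: (N %/ q)%N (N %% q)%N => k r rq.
rewrite big_split_ord/= natrD; set S := \sum_(_ < k * q) _.
set T := \sum_(_ < r) _ => St.
have T0 : 0 <= T by apply: sumr_ge0 => i _; exact: ler0n.
have Tr : T <= r%:R.
  rewrite -[X in X%:R]card_ord -sum1_card natr_sum; apply: ler_sum => i _.
  by case: (a _).
have rq' : r%:R <= q%:R :> R by rewrite ler_nat ltnW.
have -> : S + T - d * ((k * q)%:R + r%:R) = (S - d * (k * q)%:R) + (T - d * r%:R).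
  by ring.
apply: (le_trans (ler_normD _ _)); apply: lerD => //.
have dr : d * r%:R <= r%:R by rewrite ler_piMl.
have dr0 : 0 <= d * r%:R by rewrite mulr_ge0.
by rewrite ler_norml; apply/andP; split; lra.
Qed.

(** Classes 0 and 1 together contribute 1 per block, whence the term [k]; each of the other [p]
    classes telescopes from one block to the next. *)
Lemma sum_blocks (R : realType) (a : pred nat) (v : nat -> R) (p : nat) :
  (forall k, a (k * p.+2)%N) ->
  (forall k, ~~ a (k * p.+2).+1) ->
  (forall k i, (i < p)%N ->
     (a (k * p.+2 + i.+2)%N)%:R = v (k.+1 * p.+2 + i.+2)%N - v (k * p.+2 + i.+2)%N) ->
  forall k, \sum_(n < k * p.+2) (a n)%:R =
    k%:R + \sum_(i < p) (v (k * p.+2 + i.+2)%N - v i.+2).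
Proof.
move=> a0 a1 a2; elim=> [|k IH].
  by rewrite mul0n big_ord0 add0r big1// => i _; rewrite subrr.
have -> : \sum_(n < k.+1 * p.+2) (a n)%:R = \sum_(n < k * p.+2 + p.+2) (a n)%:R :> R.
  by rewrite -!(big_mkord xpredT (fun n => (a n)%:R)) mulSn addnC.
rewrite big_split_ord/= IH 2!big_ord_recl/= !addn0 !addn1 a0 (negbTE (a1 k)) add0r.
rewrite -natr1 -addrA -[RHS]addrA; congr (_ + _).
rewrite addrCA; congr (_ + _); rewrite -big_split/=; apply: eq_bigr => i _.
by rewrite a2//; ring.
Qed.

(** * An arc cut out by the cosine and counted by floors *)

Lemma cos2pi_periodic (R : realType) (u : R) (m : int) :
  cos (2 * pi * (u - m%:~R)) = cos (2 * pi * u).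
Proof.
have per n (w : R) : cos (2 * pi * (w + n%:R)) = cos (2 * pi * w).
  have -> : 2 * pi * (w + n%:R) = 2 * pi * w + (pi *+ 2) *+ n :> R.
    by ring.
  exact: (periodicn (@cosD2pi R)).
case: m => n; last by rewrite NegzE mulrNz opprK; exact: per.
by have := per n (u - n%:R); rewrite subrK => ->.
Qed.

(** Both sides test whether [u] is at distance less than b/2 from an integer: the floors count the
    integers in (u - b/2, u + b/2], at most one since b < 1. If u + b/2 were an integer, the cosines
    would agree while the floors differ by 1, hence the hypothesis. *)
Lemma cos_gt_floor (R : realType) (b u : R) : 0 < b < 1 ->
  u + b / 2 != (Num.floor (u + b / 2))%:~R ->
  (cos (pi * b) < cos (2 * pi * u))%R%:R =
  (Num.floor (u + b / 2))%:~R - (Num.floor (u - b / 2))%:~R :> R.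
Proof.
move=> /andP[b0 b1]; have := floor_itv (u + b / 2).
set m := Num.floor (u + b / 2) => /andP[]; rewrite intrD => m1 m2 m3.
have {m1 m3} m1 : m%:~R < u + b / 2 by rewrite lt_neqAle eq_sym m3.
have pi0 := pi_gt0 R.
have lt_cos (y z : R) : 0 <= y <= 1/2 -> 0 <= z <= 1/2 ->
    (cos (2 * pi * y) < cos (2 * pi * z)) = (z < y).
  move=> /andP[y0 y1] /andP[z0 z1].
  have itv (w : R) : 0 <= w -> w <= 1/2 -> 2 * pi * w \in `[0, pi]%R.
    move=> w0 w1; rewrite in_itv/=; apply/andP; split; nra.
  by rewrite ltr_cos ?itv// ltr_pM2l// mulr_gt0.
rewrite -(cos2pi_periodic u m) (_ : pi * b = 2 * pi * (b / 2)); last by field.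
(* Here y = u - m lies in (-b/2, 1 - b/2). Below b/2 the nearby integer is m; otherwise y is at
   distance at least b/2 from both 0 and 1, and for y > 1/2 the reflection 1 - y brings it back to
   the range where the cosine decreases. *)
have [le_yb|lt_by] := ltP (u - m%:~R) (b / 2).
  have -> : Num.floor (u - b / 2) = m - 1.
    by apply: floor_def; rewrite subrK intrB; apply/andP; split; lra.
  have -> : cos (2 * pi * (u - m%:~R)) = cos (2 * pi * `|u - m%:~R|).
    by rewrite -[in LHS]cos_norm normrM gtr0_norm// mulr_gt0.
  have yb : `|u - m%:~R| < b / 2 by rewrite ltr_norml; apply/andP; split; lra.
  rewrite lt_cos ?normr_ge0/=; [|lra|lra].
  by rewrite yb intrB/=; ring.
have -> : Num.floor (u - b / 2) = m.
  by apply: floor_def; rewrite intrD; apply/andP; split; lra.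
rewrite subrr; apply/eqP; rewrite pnatr_eq0 eqb0 -leNgt.
have [yh|hy] := lerP (u - m%:~R) (1/2).
  by rewrite leNgt lt_cos -?leNgt//; apply/andP; split; lra.
have -> : cos (2 * pi * (u - m%:~R)) = cos (2 * pi * (1 - (u - m%:~R))).
  rewrite -cosN -[RHS](cos2pi_periodic _ 1); congr cos; ring.
by rewrite leNgt lt_cos -?leNgt; first lra; apply/andP; split; lra.
Qed.

(** Only countably many [x] are excluded, and a countable set cannot contain [0, 1], which has
    positive measure. This provides a phase for which the rotation never hits the bad endpoint of
    the arc. *)
Lemma exists_translate_avoiding_int (R : realType) (t : nat -> R) :
  exists x, forall n (m : int), t n + x != m%:~R.
Proof.
apply: contrapT => /forallNP H.
pose g (z : nat * int) : R := z.2%:~R - t z.1.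
have cg : countable (range g) by apply: sub_countable (countableP _); exact: card_image_le.
have gT : range g = setT.
  apply/seteqP; split=> // x _.
  have /existsNP[n /existsNP[m /negP]] := H x.
  by rewrite negbK => /eqP E; exists (n, m) => //; rewrite /g/= -E; ring.
have c01 : countable [set` `[(0 : R), 1]].
  by apply: sub_countable cg; rewrite gT; exact: subset_card_le.
have /eqP := countable_lebesgue_measure0 c01.
by rewrite lebesgue_measure_itv/= lte_fin ltr01 oppr0 adde0 eqe oner_eq0.
Qed.

(** * Exponentials on the unit circle *)

Section UnitCircle.
Variable R : realType.

Definition expi2pi (t : R) : R[i] := cos (2 * pi * t) +i* sin (2 * pi * t).

Lemma expi2piD s t : expi2pi (s + t) = expi2pi s * expi2pi t.
Proof.
rewrite /expi2pi mulrDr cosD sinD; apply/eqP; rewrite eq_complex/= eqxx/=.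
by apply/eqP; rewrite addrC.
Qed.

Lemma expi2pi0 : expi2pi 0 = 1.
Proof. by rewrite /expi2pi mulr0 cos0 sin0. Qed.

Lemma expi2piMn t n : expi2pi (t *+ n) = expi2pi t ^+ n.
Proof.
by elim: n => [|n IH]; rewrite ?mulr0n ?expi2pi0// mulrS exprS expi2piD IH.
Qed.

Lemma expi2pi_nat n : expi2pi n%:R = 1.
Proof.
by rewrite expi2piMn /expi2pi mulr1 mulr_natl cos2pi sin2pi expr1n.
Qed.

Lemma expi2pi_neq0 t : expi2pi t != 0.
Proof.
apply/eqP => t0; have := expi2pi0; rewrite -(subrr t) expi2piD t0 mul0r.
by move/esym/eqP; rewrite oner_eq0.
Qed.

Lemma expi2piJ t : expi2pi t + expi2pi (- t) = (2 * cos (2 * pi * t))%:C.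
Proof.
rewrite /expi2pi mulrN cosN sinN; apply/eqP; rewrite eq_complex/=.
by rewrite subrr eqxx andbT; apply/eqP; ring.
Qed.

(** The sine vanishes in this range only at t = 1/2, where the value is -1. *)
Lemma expi2pi_not_positive t : 0 < t < 1 -> ~ positive_real (expi2pi t).
Proof.
move=> /andP[t0 t1] [r r0 [cr sr]].
have pi0 := pi_gt0 R.
have [th|th] := ltrP t (1/2).
  have : 0 < sin (2 * pi * t).
    by apply: sin_gt0_pi; apply/andP; split; nra.
  by rewrite sr ltxx.
have [th'|th'] := ltrP (1/2) t.
  have : 0 < sin (- (2 * pi * t) + pi *+ 2).
    by apply: sin_gt0_pi; rewrite -[pi *+ 2]mulr_natr; apply/andP; split; nra.
  by rewrite sinD2pi sinN sr oppr0 ltxx.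
have : cos (2 * pi * t) = -1.
  by rewrite (_ : t = 1/2) 1?(_ : 2 * pi * (1 / 2) = pi) ?cospi//; [field|lra].
by rewrite cr => ?; lra.
Qed.

Lemma expi2pi_neq1 t : 0 < t < 1 -> expi2pi t != 1.
Proof.
move=> ht; apply/eqP => t1; apply: (expi2pi_not_positive ht).
by exists 1.
Qed.

Lemma expi2pi_inj s t : 0 < s < 1 -> 0 < t < 1 -> expi2pi s = expi2pi t -> s = t.
Proof.
wlog st : s t / s <= t => [H hs ht E|].
  by have [/H|/ltW /H] := leP s t; [exact|move=> K; apply/esym/K].
move=> /andP[s0 s1] /andP[t0 t1] E; apply/eqP; rewrite eq_le st/= leNgt.
apply/negP => lt_st; have ts : 0 < t - s < 1 by apply/andP; split; lra.
by have := expi2pi_neq1 ts; rewrite expi2piD -E -expi2piD subrr expi2pi0 eqxx.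
Qed.

(** A geometric sum in z = e(n/q), where z^q = 1. It expands the indicator of the multiples of [q]
    over the q-th roots of unity. *)
Lemma sum_unity_roots (q n : nat) : (0 < q)%N ->
  \sum_(j < q) expi2pi (j%:R / q%:R) ^+ n = (q%:R * (q %| n)%:R)%:C.
Proof.
move=> q0; have qR : q%:R != 0 :> R by rewrite pnatr_eq0 -lt0n.
pose z := expi2pi (n%:R / q%:R).
have -> : \sum_(j < q) expi2pi (j%:R / q%:R) ^+ n = \sum_(j < q) z ^+ j.
  apply: eq_bigr => j _; rewrite -!expi2piMn; congr expi2pi.
  by field.
have zq : z ^+ q = 1 by rewrite -expi2piMn -[_ *+ q]mulr_natr divfK ?expi2pi_nat.
have [qn|qn] := boolP (q %| n)%N.
  have z1 : z = 1.
    by rewrite /z -(divnK qn) natrM mulfK// expi2pi_nat.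
  rewrite (eq_bigr (fun=> 1)) => [|j _]; last by rewrite z1 expr1n.
  by rewrite sumr_const card_ord mulr1 rmorph_nat.
have z1 : z != 1.
  have -> : z = expi2pi ((n %% q)%N%:R / q%:R).
    rewrite /z [in LHS](divn_eq n q) natrD natrM mulrDl mulfK// expi2piD.
    by rewrite expi2pi_nat mul1r.
  apply: expi2pi_neq1; rewrite divr_gt0 ?ltr0n//=; last by rewrite lt0n.
  by rewrite ltr_pdivrMr ?ltr0n// mul1r ltr_nat ltn_mod.
rewrite mulr0; apply: (mulfI (x := z - 1)); first by rewrite subr_eq0.
by rewrite -subrX1 zq subrr mulr0.
Qed.

End UnitCircle.

(** * The sequence, its recurrence and its characteristic roots *)

Section Construction.
Variables (R : realType) (p : nat) (b x : R).
Hypothesis b01 : 0 < b < 1.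

Local Notation q := p.+2.
Let c : R := cos (pi * b).
Let B : R := 3 * q%:R.
Let A : R := B + q%:R * c.

(** The step b/q makes one period [q] advance the rotation by exactly [b], the length of the arc. *)
Let rot (n : nat) : R := b * (n%:R / q%:R) + x.

(* [A - B = q c] makes the periodic part have mean zero, so that 1 is not a
   characteristic root; [A] and [B] are large enough to force the sign on the
   residue classes 0 and 1 modulo [q]. *)
Definition rotation_seq (n : nat) : R :=
  cos (2 * pi * rot n) - c + A * (q %| n)%:R - B * (q %| n + p.+1)%:R.

Let q_neq0 : q%:R != 0 :> R. Proof. by rewrite pnatr_eq0. Qed.

Let q_gt0 : 0 < q%:R :> R. Proof. by rewrite ltr0n. Qed.

Let c_ge : -1 <= c. Proof. exact: cos_geN1. Qed.

Let q_ge2 : 2 <= q%:R :> R. Proof. by rewrite ler_nat. Qed.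

Let B_gt0 : 0 < B. Proof. by rewrite mulr_gt0. Qed.

Let A_gt : 2 < A.
Proof.
have : 0 <= q%:R * (c + 1) by rewrite mulr_ge0//; have := c_ge; lra.
by have := q_ge2; rewrite /A /B mulrDr => ? ?; lra.
Qed.

Let rotD n : rot (n + q) = rot n + b.
Proof. by rewrite /rot natrD; field. Qed.

(** With C = cos(2 pi b), X^q - 1 kills the constant and the periodic terms, and X^(2q) - 2C X^q + 1
    kills the cosine; [w] is read off their product. That 1 is a root of this product does no harm:
    the characteristic roots come from the expansion below. *)
Lemma rotation_seq_recurrence : recurrence_sequence rotation_seq.
Proof.
pose C : R := cos (2 * pi * b).
pose w (k : nat) : R := (1 + 2 * C) * (k == p.+1)%:R
  - (1 + 2 * C) * (k == p.+1 + q)%N%:R + (k == p.+1 + q + q)%N%:R.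
exists (q + q + q)%N, (fun k => w k); split=> // n.
have delta (j : nat) (g : nat -> R) : (j < q + q + q)%N ->
    \sum_(k < q + q + q) (k == j :> nat)%:R * g k = g j.
  move=> jq; rewrite (bigD1 (Ordinal jq))//= eqxx mul1r big1 ?addr0// => i.
  by rewrite -val_eqE/= => /negbTE ->; rewrite mul0r.
pose g k := rotation_seq (n + (q + q + q) - k.+1).
transitivity (\sum_(k < q + q + q) ((1 + 2 * C) * ((k == p.+1 :> nat)%:R * g k)
  - (1 + 2 * C) * ((k == p.+1 + q :> nat)%N%:R * g k)
  + (k == p.+1 + q + q :> nat)%N%:R * g k)); last first.
  by apply: eq_bigr => k _; rewrite /w /g; ring.
rewrite 2!big_split/= sumrN -!mulr_sumr !delta; try lia.
have gE1 : g p.+1 = rotation_seq (n + q + q) by congr rotation_seq; lia.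
have gE2 : g (p.+1 + q)%N = rotation_seq (n + q) by congr rotation_seq; lia.
have gE3 : g (p.+1 + q + q)%N = rotation_seq n by congr rotation_seq; lia.
rewrite gE1 gE2 gE3 !addnA /rotation_seq.
have dvE (m : nat) : (q %| m + q)%N = (q %| m)%N by rewrite dvdn_addl.
have addAC m : (m + q + p.+1 = m + p.+1 + q)%N by lia.
rewrite !addAC !dvE !rotD.
have cos2E (s : R) : cos (2 * pi * (s + b + b)) =
    2 * C * cos (2 * pi * (s + b)) - cos (2 * pi * s).
  have -> : 2 * pi * (s + b + b) = 2 * pi * (s + b) + 2 * pi * b by ring.
  have -> : 2 * pi * s = 2 * pi * (s + b) - 2 * pi * b by ring.
  by rewrite cosD cosB /C; ring.
by rewrite !cos2E; ring.
Qed.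

(** The nontrivial q-th roots of unity come from the periodic part. The end slots 0 and q, where k/q
    would give the root 1, hold the two frequencies b/q and -b/q of the cosine, the latter taken
    modulo 1; the list is then increasing in (0, 1). *)
Definition rotation_angle (k : 'I_q.+1) : R :=
  if k == 0 then b / q%:R else if k == ord_max then 1 - b / q%:R else k%:R / q%:R.

(** The inner values are the discrete Fourier coefficients of the periodic part, the outer two the
    halves of the cosine with phase [x]. *)
Definition rotation_coef (k : 'I_q.+1) : R[i] :=
  if k == 0 then expi2pi x / 2 else if k == ord_max then expi2pi (- x) / 2
  else (A%:C - B%:C * expi2pi (k%:R / q%:R) ^+ p.+1) / q%:R.

Let bq : 0 < b / q%:R < q%:R^-1.
Proof.
by case/andP: b01 => *; rewrite divr_gt0//= ltr_pdivrMr// mulVf.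
Qed.

Let qV : 0 < (q%:R^-1 : R) <= 1/2.
Proof. by rewrite invr_gt0 q_gt0/= mul1r lef_pV2 ?posrE. Qed.

Lemma rotation_angle_mono : {homo rotation_angle : i j / (i < j)%N >-> i < j}.
Proof.
move=> i j ij; case/andP: bq => bq0 bq1; case/andP: qV => q0 qV2.
rewrite /rotation_angle.
have -> : (j == 0) = false by exact: gtn_eqF (leq_ltn_trans (leq0n i) ij).
have -> : (i == ord_max) = false by exact: ltn_eqF (leq_trans ij (leq_ord j)).
have [i0|i0] := eqVneq i 0; have [jm|jm] := eqVneq j ord_max.
- by move: (lt_le_trans bq1 qV2); set r := b / _ => r2; lra.
- apply: (lt_le_trans bq1); rewrite -[leLHS]mul1r ler_pM2r// ler1n.
  exact: leq_ltn_trans (leq0n i) ij.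
- apply: (@le_lt_trans _ _ (1 - q%:R^-1)); last by rewrite ltrD2l ltrN2.
  rewrite ler_pdivrMr// mulrBl mul1r mulVf// lerBrDr natr1 ler_nat.
  exact: leq_trans ij (leq_ord j).
- by rewrite ltr_pM2r// ltr_nat.
Qed.

Lemma rotation_angle01 k : 0 < rotation_angle k < 1.
Proof.
case/andP: bq => bq0 bq1; case/andP: qV => q0 qV2.
have a0 : 0 < rotation_angle 0 by rewrite /rotation_angle eqxx.
have a1 : rotation_angle ord_max < 1 by rewrite /rotation_angle eqxx/= ltrBlDr ltrDl.
apply/andP; split.
  case: (posnP k) => [k0|]; first by rewrite (_ : k = 0)//; apply: val_inj.
  by move/(rotation_angle_mono (x := 0))/(lt_trans a0).
have := leq_ord k; rewrite leq_eqVlt => /orP[/eqP km|].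
  by rewrite (_ : k = ord_max)//; apply: val_inj.
by move/(rotation_angle_mono (y := ord_max))/lt_trans; apply.
Qed.

(** If an inner coefficient vanished, then A = B z^(q-1) = B / z for a root of unity z other than 1,
    so z = B / A would be a positive real. *)
Lemma rotation_coef_neq0 k : rotation_coef k != 0.
Proof.
have two0 : 2 != 0 :> R[i] by rewrite pnatr_eq0.
rewrite /rotation_coef; case: ifPn => [_|k0].
  by rewrite mulf_neq0 ?invr_eq0// expi2pi_neq0.
case: ifPn => [_|km]; first by rewrite mulf_neq0 ?invr_eq0// expi2pi_neq0.
rewrite mulf_neq0 ?invr_eq0 ?pnatr_eq0// subr_eq0; apply/eqP => AB.
have k01 := rotation_angle01 k; move: k01.
rewrite /rotation_angle (negbTE k0) (negbTE km) => k01.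
pose z := expi2pi (k%:R / q%:R : R).
have zq : z ^+ q = 1 by rewrite -expi2piMn -[_ *+ q]mulr_natr divfK ?expi2pi_nat.
apply: (expi2pi_not_positive k01); exists (B / A); first by rewrite divr_gt0//; have := A_gt; lra.
have A0 : A%:C != 0 :> R[i].
  by rewrite (fmorph_eq0 (real_complex R)) gt_eqF//; have := A_gt; lra.
apply: (mulfI A0); rewrite -rmorphM/= mulrC [in RHS]mulrC divfK ?gt_eqF//; last by have := A_gt; lra.
by rewrite AB -/z mulrCA -exprS zq mulr1.
Qed.

Lemma rotation_seq_expansion :
  characteristic_expansion rotation_seq (fun k => expi2pi (rotation_angle k))
    (fun k => (rotation_coef k)%:P).
Proof.
split=> [i j E|k|k|n].
- have {}E := expi2pi_inj (rotation_angle01 i) (rotation_angle01 j) E.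
  by apply: val_inj; case: (ltngtP i j) => // /rotation_angle_mono;
    rewrite E ltxx.
- exact: expi2pi_neq0.
- by rewrite polyC_eq0 rotation_coef_neq0.
pose G (j : nat) : R[i] := (A%:C - B%:C * expi2pi (j%:R / q%:R) ^+ p.+1) / q%:R *
  expi2pi (j%:R / q%:R) ^+ n.
have divC (y : R) : (y / q%:R)%:C = y%:C / q%:R.
  by rewrite rmorphM fmorphV rmorph_nat.
have sumG : \sum_(j < q) G j = (A * (q %| n)%:R - B * (q %| n + p.+1)%:R)%:C.
  transitivity ((A / q%:R)%:C * (\sum_(j < q) expi2pi (j%:R / q%:R) ^+ n) -
    (B / q%:R)%:C * \sum_(j < q) expi2pi (j%:R / q%:R) ^+ (n + p.+1)).
    rewrite !mulr_sumr -sumrB; apply: eq_bigr => j _.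
    by rewrite /G !divC exprD; ring.
  rewrite !sum_unity_roots// -!rmorphM -rmorphB/=; congr (_%:C).
  by field.
(* The coefficient of the root 1 is (A - B)/q = c, which cancels the constant [- c] of the
   sequence. *)
have G0 : G 0%N = c%:C.
  rewrite /G mul0r expi2pi0 !expr1n !mulr1 -rmorphB/= -divC; congr (_%:C).
  by rewrite /A; field.
under eq_bigr do rewrite hornerC.
rewrite big_ord_recl big_ord_recr.
transitivity (expi2pi (rot n) / 2 + (\sum_(i < p.+1) G i.+1 + expi2pi (- rot n) / 2)).
  have -> : \sum_(i < p.+1) G i.+1 =
      (A * (q %| n)%:R - B * (q %| n + p.+1)%:R - c)%:C.
    by rewrite [RHS]rmorphB/= -sumG -G0 [in RHS]big_ord_recl/= addrAC subrr add0r.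
  rewrite addrCA -mulrDl expi2piJ -(rmorph_nat (real_complex R) 2) -fmorphV.
  rewrite -rmorphM -rmorphD; congr (_%:C).
  by rewrite /rotation_seq; field.
congr (_ + (_ + _)).
- rewrite /rotation_coef /rotation_angle eqxx mulrAC -expi2piMn -expi2piD.
  by congr (expi2pi _ / _); rewrite /rot; field.
- apply: eq_bigr => i _; rewrite /rotation_coef /rotation_angle.
  have -> : (lift ord0 (widen_ord (leqnSn p.+1) i) == 0) = false by [].
  have -> : (lift ord0 (widen_ord (leqnSn p.+1) i) == ord_max) = false.
    by apply/negbTE; rewrite -val_eqE/= eqSS ltn_eqF.
  by [].
- rewrite (_ : lift ord0 ord_max = ord_max); last exact: val_inj.
  rewrite /rotation_coef /rotation_angle eqxx mulrAC -expi2piMn -expi2piD.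
  have -> : - x + (1 - b / q%:R) *+ n = n%:R - rot n by rewrite /rot; field.
  by rewrite expi2piD expi2pi_nat mul1r.
Qed.

Lemma rotation_seq_no_positive_root (k : 'I_q.+1) :
  ~ positive_real (expi2pi (rotation_angle k)).
Proof. exact: expi2pi_not_positive (rotation_angle01 k). Qed.

(** * Signs in the residue classes and the density *)

Hypothesis rot_int : forall n (m : int), rot n + b / 2 != m%:~R.

Let pos n : bool := 0 < rotation_seq n.

Let modq k i : (i < q)%N -> (q %| k * q + i)%N = (i == 0)%N.
Proof. by move=> iq; rewrite dvdn_addr ?dvdn_mull// /dvdn modn_small. Qed.

Lemma rotation_seq_class0 k : pos (k * q).
Proof.
have dvq : (q %| k * q)%N by exact: dvdn_mull.
rewrite /pos /rotation_seq dvq modq//= mulr1 mulr0 subr0.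
have := cos_geN1 (2 * pi * rot (k * q)); have := cos_le1 (pi * b); rewrite -/c.
by have := A_gt; lra.
Qed.

(** As p + 1 = q - 1, the term in [B] lives on the class of 1; there cos - c is at most 2, while B
    is at least 6. *)
Lemma rotation_seq_class1 k : ~~ pos (k * q).+1.
Proof.
rewrite /pos /rotation_seq -leNgt -[(k * q).+1]addn1 modq//= mulr0 addr0.
have -> : (k * q + 1 + p.+1 = k.+1 * q)%N by rewrite -addnA add1n mulSn addnC.
have dvq : (q %| k.+1 * q)%N by exact: dvdn_mull.
rewrite dvq mulr1.
have := cos_le1 (2 * pi * rot (k * q + 1)).
by have := q_ge2; have := c_ge; rewrite /B => ? ? ?; lra.
Qed.

Let v n : R := (Num.floor (rot n - b / 2))%:~R.

(** After one period the lower end rot - b/2 of the window sits where its upper end rot + b/2 was,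
    so the difference of floors is a difference of values of [v]. *)
Lemma rotation_seq_class k i : (i < p)%N ->
  (pos (k * q + i.+2)%N)%:R = v (k.+1 * q + i.+2)%N - v (k * q + i.+2)%N.
Proof.
move=> ip; set n := (k * q + i.+2)%N.
have -> : (k.+1 * q + i.+2 = n + q)%N by rewrite mulSn -addnA addnC.
have bV : rot n + b - b / 2 = rot n + b / 2 by field.
rewrite /v rotD bV -cos_gt_floor//.
rewrite /pos /rotation_seq modq//=.
have -> : (n + p.+1 = k.+1 * q + i.+1)%N.
  by rewrite /n mulSn [(q + _)%N]addnC -!addnA; congr addn; rewrite !addSn !addnS addnC.
by rewrite modq ?mulr0 ?addr0 ?subr0 ?subr_gt0// ltnW.
Qed.

Lemma rotation_seq_density :
  has_natural_density [set n | 0 < rotation_seq n] ((1 + p%:R * b) / q%:R).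
Proof.
have [b0 b1] := andP b01.
have pb : 0 <= p%:R * b <= p%:R by rewrite ler_piMr// ?mulr_ge0// ltW.
(* The error is below 1 for each of the [p] telescoping classes, and at most [q] for the incomplete
   block. *)
apply: (@natural_density_bounded_discrepancy _ pos _ (p%:R + q%:R)).
apply: bounded_discrepancy_mul => // [|k].
  case/andP: pb => pb0 pb1; apply/andP; split; first by rewrite divr_ge0// addr_ge0.
  by rewrite ler_pdivrMr// mul1r -addn2 natrD; lra.
rewrite (sum_blocks rotation_seq_class0 rotation_seq_class1 rotation_seq_class).
have -> : k%:R + \sum_(i < p) (v (k * q + i.+2) - v i.+2) -
    (1 + p%:R * b) / q%:R * (k * q)%:R =
    \sum_(i < p) (v (k * q + i.+2) - v i.+2 - b * k%:R).
  rewrite [in RHS]big_split/= sumr_const card_ord natrM -[_ *+ p]mulr_natr.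
  by field.
apply: (le_trans (ler_norm_sum _ _ _)).
apply: (@le_trans _ _ (\sum_(i < p) 1)); last by rewrite sumr_const card_ord.
apply: ler_sum => i _.
have rE : rot (k * q + i.+2) = rot i.+2 + b * k%:R.
  by rewrite /rot natrD natrM; field.
have /andP[] := floor_itv (rot (k * q + i.+2) - b / 2).
have /andP[] := floor_itv (rot i.+2 - b / 2).
rewrite !intrD -/(v _) -/(v (k * q + i.+2)) rE => ? ? ? ?.
by rewrite ler_norml; apply/andP; split; lra.
Qed.

End Construction.

Theorem theorem11 (R : realType) (kappa : R) (hkappa : 0 < kappa < 1) :
  exists (f : nat -> R) (m : nat) (gamma : 'I_m.+1 -> R[i])
         (P : 'I_m.+1 -> {poly R[i]}),
    [/\ recurrence_sequence f,
        characteristic_expansion f gamma P,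
        forall k, dominating gamma k -> ~ positive_real (gamma k) &
        has_natural_density [set n : nat | 0 < f n] kappa].
Proof.
case/andP: hkappa => k0 k1.
have k1' : 0 < 1 - kappa by rewrite subr_gt0.
(* This [y] exceeds both inverses, so q = p + 2 satisfies q kappa > 1 and q (1 - kappa) > 1; also y
   > 2 gives p > 0. *)
pose y := kappa^-1 + (1 - kappa)^-1; pose p := Num.truncn y.
have [kV kV'] : 1 < kappa^-1 /\ 1 < (1 - kappa)^-1.
  by split; rewrite invf_gt1//; lra.
have yp : y < p.+1%:R by exact: truncnS_gt.
have p0 : (0 < p)%N by rewrite truncn_gt0 /y; lra.
have p0' : 0 < p%:R :> R by rewrite ltr0n.
have qE : p.+2%:R = p%:R + 2 :> R by rewrite -addn2 natrD.
have qk : 1 < p.+2%:R * kappa.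
  by rewrite -ltr_pdivrMr// mul1r qE; move: yp; rewrite -natr1 /y; lra.
have qk' : 1 < p.+2%:R * (1 - kappa).
  by rewrite -ltr_pdivrMr// mul1r qE; move: yp; rewrite -natr1 /y; lra.
(* The solution of (1 + p b) / q = kappa; the two inequalities above say exactly that 0 < b and b <
   1. *)
pose b := (p.+2%:R * kappa - 1) / p%:R.
have b01 : 0 < b < 1.
  rewrite /b divr_gt0//= ?subr_gt0// ltr_pdivrMr// mul1r.
  by move: qk'; rewrite mulrBr mulr1 qE; lra.
have [x xP] := exists_translate_avoiding_int (fun n => b * (n%:R / p.+2%:R) + b / 2).
exists (rotation_seq p b x), p.+2, (fun k => expi2pi (rotation_angle b k)),
  (fun k => (rotation_coef b x k)%:P); split.
- exact: rotation_seq_recurrence.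
- exact: rotation_seq_expansion.
- by move=> k _; exact: rotation_seq_no_positive_root.
have -> : kappa = (1 + p%:R * b) / p.+2%:R.
  rewrite [p%:R * b]mulrC divfK ?gt_eqF// addrC subrK.
  by rewrite [p.+2%:R * kappa]mulrC mulfK ?pnatr_eq0.
apply: rotation_seq_density => // n m.
by rewrite addrAC; exact: xP.
Qed.
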